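(* Let $\mathbf{P}_i$ be the set of feasible trajectories of robot $r_i$ and let $A_i\subseteq\mathbf{P}_i$ be a minimal action set of robot $r_i$ (both as defined in the context), for $i=1,\dots,n$. Then $\mathbf{P}=\mathbf{P}_1\times\cdots\times\mathbf{P}_n$ and $A=A_1\times\cdots\times A_n$ satisfy $$\max_{\mathbf{p}\in\mathbf{P}}f(\mathbf{p})=\max_{\mathbf{p}\in A}f(\mathbf{p}),$$ where $f(\mathbf{p})=\sum_{\tau_j\in\tau}v_j(\mathbf{c}_j(\mathbf{p}))$.
   Context: **Environment and trajectories.** $P=\{1,\dots,\bar x\}\times\{1,\dots,\bar y\}$ with $\bar x,\bar y\in\mathbb{Z}_+$ is a grid, $P_F\subseteq P$ is the set of feasible cells, and $S\subseteq P_F$ is the set of station cells. For $p=(x,y)\in P_F$, $N(p)=\{(x',y')\in P_F: |x'-x|\le 1,\ |y'-y|\le 1\}$. There are $n$ robots $R=\{r_1,\dots,r_n\}$; robot $r_i$ is assigned a station $\sigma_i\in S$ (several robots may share a station). With $T\in\mathbb{Z}_+$ the episode length, the set of feasible trajectories of $r_i$ is $\mathbf{P}_i=\{\mathbf{p}_i=(p_i^0,\dots,p_i^T): p_i^0=p_i^T=\sigma_i,\ p_i^{t+1}\in N(p_i^t)\ \forall t<T\}$. **Tasks.** $\tau=\{\tau_1,\dots,\tau_m\}$ is a finite set of tasks, $\tau_j=(\ell_j,t^a_j,t^d_j,v_j)$, with location $\ell_j\in P_F$, arrival and departure times $t^a_j<t^d_j$ in $\{0,\dots,T\}$, and value function $v_j$.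 Tasks at the same location have non-overlapping windows: if $i\ne j$ and $\ell_i=\ell_j$ then $\min\{t^d_i,t^d_j\}\le\max\{t^a_i,t^a_j\}$. For $\mathbf{p}\in\mathbf{P}$, $c_j(\mathbf{p},t)=|\{r_k\in R: p_k^t=p_k^{t+1}=\ell_j\}|$ and $\mathbf{c}_j(\mathbf{p})=[c_j(\mathbf{p},t^a_j),\dots,c_j(\mathbf{p},t^d_j-1)]^{\mathsf T}$. The function $v_j$ maps such count vectors to $[0,\bar v_j]$, where $\bar v_j>0$ is the maximum value of the task, and is monotone: for $\mathbf{p},\mathbf{p}'\in\mathbf{P}$, $\mathbf{c}_j(\mathbf{p})\ge\mathbf{c}_j(\mathbf{p}')$ entrywise implies $v_j(\mathbf{c}_j(\mathbf{p}))\ge v_j(\mathbf{c}_j(\mathbf{p}'))$. **Minimal action sets.** For $\mathbf{q}_i\in\mathbf{P}_i$ let $t^*(\mathbf{q}_i,\tau)=\{t: \exists\,\tau_j\in\tau,\ q_i^t=q_i^{t+1}=\ell_j,\ t^a_j\le t<t^d_j\}$. The action set $A_i$ is a minimum-cardinality set among all nonempty $A_i'\subseteq\mathbf{P}_i$ satisfying: for every $\mathbf{q}_i\in\mathbf{P}_i\setminus A_i'$ there is $\mathbf{p}_i\in A_i'$ such that $p_i^t=p_i^{t+1}=q_i^t$ for all $t\in t^*(\mathbf{q}_i,\tau)$. *)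

(* Defs.v *)
From mathcomp Require Import all_boot all_order all_algebra.

Set Implicit Arguments.
Unset Strict Implicit.
Unset Printing Implicit Defensive.

Import Order.TTheory GRing.Theory Num.Theory.
Local Open Scope ring_scope.

(* The grid {1, ..., xbar} x {1, ..., ybar}, with coordinates renumbered from
   0; only coordinate differences are ever used. *)
Definition cell (xbar ybar : nat) : finType := ('I_xbar * 'I_ybar)%type.

(* A sequence of cells (p^0, ..., p^T). *)
Definition traj (xbar ybar T : nat) : finType :=
  {ffun 'I_T.+1 -> cell xbar ybar}.

Definition joint_traj (xbar ybar T n : nat) : finType :=
  {dffun forall _ : 'I_n, traj xbar ybar T}.

(* p^t; only meaningful, and only used, for t <= T. *)
Definition at_time (xbar ybar T : nat) (p : traj xbar ybar T) (t : nat) :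
  cell xbar ybar := p (inord t).

Definition neighbors (xbar ybar : nat) (PF : {set cell xbar ybar})
    (p : cell xbar ybar) : {set cell xbar ybar} :=
  [set q in PF | (`|q.1%:Z - p.1%:Z| <= 1) && (`|q.2%:Z - p.2%:Z| <= 1)].

Definition feasible_trajs (xbar ybar T : nat) (PF : {set cell xbar ybar})
    (s : cell xbar ybar) : {set traj xbar ybar T} :=
  [set p : traj xbar ybar T | [&& at_time p 0 == s, at_time p T == s &
    [forall t : 'I_T, at_time p t.+1 \in neighbors PF (at_time p t)]]].

Definition feasible_joint_trajs (xbar ybar T n : nat)
    (PF : {set cell xbar ybar}) (sigma : 'I_n -> cell xbar ybar) :
    {set joint_traj xbar ybar T n} :=
  setXn (fun i => feasible_trajs T PF (sigma i)).

(* The value function is given on all vectors of naturals of length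
   departure - arrival; it is constrained only on the count vectors of
   feasible joint trajectories. *)
Record task (R : realFieldType) (xbar ybar T : nat) := Task {
  loc : cell xbar ybar;
  arrival : 'I_T.+1;
  departure : 'I_T.+1;
  max_value : R;
  value : (departure - arrival)%N.-tuple nat -> R
}.

Definition count_at (xbar ybar T n : nat) (l : cell xbar ybar)
    (p : joint_traj xbar ybar T n) (t : nat) : nat :=
  #|[set k : 'I_n | (at_time (p k) t == l) && (at_time (p k) t.+1 == l)]|.

(* [c(p, ta), ..., c(p, td - 1)], where ta and td are the arrival and the
   departure time of the task. *)
Definition counts (R : realFieldType) (xbar ybar T n : nat)
    (a : task R xbar ybar T) (p : joint_traj xbar ybar T n) :
    (departure a - arrival a)%N.-tuple nat :=
  [tuple count_at (loc a) p (arrival a + k) | k < departure a - arrival a].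

Definition essential_times (R : realFieldType) (xbar ybar T m : nat)
    (tau : 'I_m -> task R xbar ybar T) (q : traj xbar ybar T) : {set 'I_T} :=
  [set t : 'I_T | [exists j : 'I_m,
    [&& at_time q t == loc (tau j), at_time q t.+1 == loc (tau j)
      & (arrival (tau j) <= t < departure (tau j))%N]]].

Definition sufficient_action_set (R : realFieldType) (xbar ybar T m : nat)
    (PF : {set cell xbar ybar}) (s : cell xbar ybar)
    (tau : 'I_m -> task R xbar ybar T) (B : {set traj xbar ybar T}) : Prop :=
  [/\ B != set0, B \subset feasible_trajs T PF s &
    forall q, q \in feasible_trajs T PF s :\: B ->
    exists2 p, p \in B &
      forall t : 'I_T, t \in essential_times tau q ->
        at_time p t = at_time q t /\ at_time p t.+1 = at_time q t].

Definition minimal_action_set (R : realFieldType) (xbar ybar T m : nat)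
    (PF : {set cell xbar ybar}) (s : cell xbar ybar)
    (tau : 'I_m -> task R xbar ybar T) (A : {set traj xbar ybar T}) : Prop :=
  sufficient_action_set PF s tau A /\
  forall B, sufficient_action_set PF s tau B -> (#|A| <= #|B|)%N.

Definition total_value (R : realFieldType) (xbar ybar T n m : nat)
    (tau : 'I_m -> task R xbar ybar T) (p : joint_traj xbar ybar T n) : R :=
  \sum_(j < m) value (counts (tau j) p).

(* M = max_(x in X) f x; in particular the maximum is attained. *)
Definition is_max (R : realFieldType) (I : finType) (X : {set I}) (f : I -> R)
    (M : R) : Prop :=
  (exists2 x, x \in X & f x = M) /\ forall x, x \in X -> f x <= M.

(* Main.v *)
(* Replacing each trajectory q of a joint feasible trajectory by the trajectory
   of the action set that stays at q^t whenever t is essential for q can only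
   increase every task count. By monotonicity of the task values, each joint
   feasible trajectory is dominated by a joint trajectory of the action sets. *)
Require Import Defs.
From mathcomp Require Import all_boot all_order all_algebra.

Set Implicit Arguments.
Unset Strict Implicit.
Unset Printing Implicit Defensive.

Import Order.TTheory GRing.Theory Num.Theory.
Local Open Scope ring_scope.

(** A maximiser of [f] on the finite nonempty set [Y] lies in [X], and domination makes its value an
    upper bound on [X] as well. *)
Lemma dominated_is_max (R : realFieldType) (I : finType) (X Y : {set I})
    (f : I -> R) :
  Y != set0 -> Y \subset X ->
  (forall x, x \in X -> exists2 y, y \in Y & f x <= f y) ->
  exists M, is_max X f M /\ is_max Y f M.
Proof.
move=> /set0Pn[y0 Yy0] /subsetP sYX dom.
case: (Order.TotalTheory.arg_maxP f Yy0) => y Yy ymax.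
exists (f y); split; split; first by exists y => //; apply: sYX.
- by move=> x /dom[z Yz /le_trans]; apply; apply: ymax.
- by exists y.
- exact: ymax.
Qed.

Lemma setXn_neq0 (I : finType) (U : I -> finType) (A : forall i, {set U i}) :
  (forall i, A i != set0) -> setXn A != set0.
Proof.
move=> A0; have A_ex i : exists x, x \in A i by apply/set0Pn.
apply/set0Pn; exists [ffun i => xchoose (A_ex i)].
by apply/setXnP => i; rewrite ffunE; apply: xchooseP.
Qed.

Lemma setXn_subset (I : finType) (U : I -> finType)
    (A B : forall i, {set U i}) :
  (forall i, A i \subset B i) -> setXn A \subset setXn B.
Proof.
move=> sAB; apply/subsetP => p /setXnP Ap; apply/setXnP => i.
by rewrite (subsetP (sAB i)).
Qed.

Section ActionSets.

Variables (R : realFieldType) (xbar ybar T m : nat).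
Variables (PF : {set cell xbar ybar}) (tau : 'I_m -> task R xbar ybar T).

(** Boolean form of the covering condition in [sufficient_action_set], so that [xchoose] can select
    a covering trajectory for each robot. *)
Definition keeps_essential_stays (q p : traj xbar ybar T) : bool :=
  [forall t in essential_times tau q,
    (at_time p t == at_time q t) && (at_time p t.+1 == at_time q t)].

(** At an essential time [q] rests at a task location, so its next cell equals its current one. This
    lets members of an action set cover themselves. *)
Lemma essential_stays_refl q : keeps_essential_stays q q.
Proof.
apply/forall_inP => t; rewrite inE => /existsP[j].
by case/and3P=> /eqP-> /eqP-> _; rewrite eqxx.
Qed.

Lemma sufficient_action_setP (s : cell xbar ybar) (B : {set traj xbar ybar T}) q :
  sufficient_action_set PF s tau B -> q \in feasible_trajs T PF s ->
  exists p, (p \in B) && keeps_essential_stays q p.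
Proof.
move=> [_ _ suff] Pq; have [Bq|nBq] := boolP (q \in B).
  by exists q; rewrite Bq essential_stays_refl.
have [|p Bp stay] := suff q; first by rewrite inE nBq.
exists p; rewrite Bp; apply/forall_inP => t /stay[-> ->].
by rewrite eqxx.
Qed.

(** Any robot counted for [p] is counted for [p']: its stay at the task location falls within the
    task window, hence at an essential time, and [p'] repeats that stay. *)
Lemma leq_counts n j (p p' : joint_traj xbar ybar T n) :
  (forall i, keeps_essential_stays (p i) (p' i)) ->
  forall k, (tnth (counts (tau j) p) k <= tnth (counts (tau j) p') k)%N.
Proof.
move=> stay k; rewrite !tnth_mktuple; apply: subset_leq_card.
apply/subsetP => i; rewrite !inE => /andP[l0 l1].
(* Entry [k] of the count vector refers to time [arrival (tau j) + k]. As departures are at most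
   [T], this time is an element of ['I_T], the index type of essential times. *)
have lt_dep : (arrival (tau j) + k < departure (tau j))%N.
  by rewrite -ltn_subRL.
have lt_T : (arrival (tau j) + k < T)%N.
  by apply: leq_trans lt_dep _; rewrite -ltnS.
have /forall_inP/(_ (Ordinal lt_T)) := stay i.
rewrite inE; case/(_ _)/andP => [|/eqP-> /eqP->]; last by rewrite l0.
by apply/existsP; exists j; rewrite l0 l1 leq_addr.
Qed.

End ActionSets.

Theorem lemma1 (R : realFieldType) (xbar ybar T n m : nat)
    (PF S : {set cell xbar ybar}) (hS : S \subset PF)
    (sigma : 'I_n -> cell xbar ybar) (hsigma : forall i, sigma i \in S)
    (tau : 'I_m -> task R xbar ybar T)
    (hloc : forall j, loc (tau j) \in PF)
    (hwindow : forall j, (arrival (tau j) < departure (tau j))%N)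
    (hdisjoint : forall i j, i != j -> loc (tau i) = loc (tau j) ->
      (minn (departure (tau i)) (departure (tau j)) <=
       maxn (arrival (tau i)) (arrival (tau j)))%N)
    (hmax_value : forall j, 0 < max_value (tau j))
    (hrange : forall j p, p \in feasible_joint_trajs T PF sigma ->
      0 <= value (counts (tau j) p) <= max_value (tau j))
    (hmonotone : forall j p p',
      p \in feasible_joint_trajs T PF sigma ->
      p' \in feasible_joint_trajs T PF sigma ->
      (forall k, (tnth (counts (tau j) p') k <= tnth (counts (tau j) p) k)%N) ->
      value (counts (tau j) p') <= value (counts (tau j) p))
    (A : 'I_n -> {set traj xbar ybar T})
    (hA : forall i, minimal_action_set PF (sigma i) tau (A i)) :
  exists M : R,
    is_max (feasible_joint_trajs T PF sigma) (total_value tau) M /\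
    is_max (setXn A : {set joint_traj xbar ybar T n}) (total_value tau) M.
Proof.
have suffA i : sufficient_action_set PF (sigma i) tau (A i) by case: (hA i).
have sAP : setXn A \subset feasible_joint_trajs T PF sigma.
  by apply: setXn_subset => i; case: (suffA i).
apply: dominated_is_max => //.
  by apply: setXn_neq0 => i; case: (suffA i).
move=> p Pp; have /setXnP Ppi := Pp.
have ex_dom i := sufficient_action_setP (suffA i) (Ppi i).
(* Counts are compared robot by robot, so the covering trajectories can be chosen independently. *)
pose p' : joint_traj xbar ybar T n := [ffun i => xchoose (ex_dom i)].
have /all_and2[Ap' stay] i :
    p' i \in A i /\ keeps_essential_stays tau (p i) (p' i).
  by rewrite ffunE; apply/andP; apply: (xchooseP (ex_dom i)).
have Ap'X : p' \in setXn A by apply/setXnP.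
exists p' => //; apply: ler_sum => j _.
(* Monotonicity is assumed between feasible joint trajectories only, so [p'] must be shown feasible;
   this follows from [sAP]. *)
apply: hmonotone => //; first exact: (subsetP sAP).
exact: leq_counts.
Qed.
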